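(* For every integer $n\ge 0$: (i) $c_3(5n+1)$ is odd if and only if $10n+2=j(j+1)$ for some integer $j\ge 1$ with $j\equiv 1$ or $3 \pmod 5$; (ii) $c_3(5n+2)$ is odd if and only if $5n+2=(5j+4)(15j+13)$ for some $j\in\mathbb{Z}$; (iii) $c_3(5n+3)$ is odd if and only if $10n+6=(5j+2)(5j+3)$ for some integer $j\ge 0$; (iv) $c_3(5n+4)$ is odd if and only if $5n+4=j(3j+1)$ for some $j\in\mathbb{Z}$ with $j\equiv 1$ or $2\pmod 5$.
   Context: A partition of $n\ge 0$ is a finite multiset of positive integers summing to $n$. For $n\ge 0$, $c_3(n)$ denotes the number of partitions $\lambda$ of $n$ for which there exists an integer $j\ge 1$ such that: the part $1$ appears in $\lambda$ exactly $j^2$ or exactly $j^2+1$ times; every odd part greater than $1$ appears at most once; the even parts of $\lambda$ are distinct; and every even part of $\lambda$ is either at most $2j$, or is a multiple of $4$ that is at least $4j+4$ (in particular no even integer in $\{2j+2,2j+4,\dots,4j+2\}$ is a part). *)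

(* Defs.v *)
From mathcomp Require Import all_boot all_order all_algebra.
Set Implicit Arguments. Unset Strict Implicit. Unset Printing Implicit Defensive.

(* A partition of n is encoded by its multiplicity function:
   m : {ffun 'I_n -> 'I_n.+1}, where m i is the number of times the part
   (i+1) occurs (parts of a partition of n lie in 1..n, and each
   multiplicity is at most n).  This is a bijective encoding of partitions. *)
Definition mult (n : nat) (m : {ffun 'I_n -> 'I_n.+1}) (k : nat) : nat :=
  match insub k.-1 with
  | Some i => if 0 < k then nat_of_ord (m i) else 0
  | None => 0
  end.

Definition is_partition_of (n : nat) (m : {ffun 'I_n -> 'I_n.+1}) : bool :=
  \sum_(i < n) (i.+1 * m i) == n.

Definition c3_cond_j (n : nat) (m : {ffun 'I_n -> 'I_n.+1}) (j : nat) : bool :=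
  [&& 1 <= j,
      (mult m 1 == j ^ 2) || (mult m 1 == (j ^ 2).+1),
      [forall i : 'I_n, (odd i.+1 && (1 < i.+1)) ==> (m i <= 1)],
      [forall i : 'I_n, ~~ odd i.+1 ==> (m i <= 1)] &
      [forall i : 'I_n, (~~ odd i.+1 && (0 < m i)) ==>
                         ((i.+1 <= 2 * j) || ((4 %| i.+1) && (4 * j + 4 <= i.+1)))]].

(* Existence of j >= 1; since j^2 <= mult m 1 <= n, it suffices to search j <= n. *)
Definition c3_cond (n : nat) (m : {ffun 'I_n -> 'I_n.+1}) : bool :=
  has (c3_cond_j m) (iota 1 n).

Definition c3 (n : nat) : nat :=
  #|[set m : {ffun 'I_n -> 'I_n.+1} | is_partition_of m && c3_cond m]|.

(* Main.v *)
(** Every admissible partition determines its [j], so the generating function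
    of [c3] is
      sum_(j >= 1) q^(j^2) prod_(k odd) (1 + q^k)
        prod_(k <= j) (1 + q^(2k)) prod_(k > j) (1 + q^(4k)).
    Modulo 2 one has [1 + q^(4k) = (1 - q^(2k))^2], so this equals
      O * Q * sum_(j >= 1) q^(j^2) / (q^2; q^2)_j
    with [O] the product of the [1 + q^k], [k] odd, and [Q] that of the
    [1 - q^(4k)].  By Euler's identity the last sum is [O - 1].  Jacobi's
    triple product gives [O * Q = sum_l q^(l (2l+1))] and, modulo 2,
    [O^2 * Q = prod_k (1 - q^(2k)) = sum_l q^(l (3l+1))], [l] running over Z.
    So [c3 n] is odd iff [n] has exactly one of the forms [l (2l+1)] and
    [l (3l+1)]; the former is 0, 1 or 3 modulo 5 and the latter 0, 2 or 4.

    Power series are truncated at order [N] by computing in a commutative ring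
    with an element [x] such that [x ^+ N = 0], eventually
    [{poly %/ 'X^N}] over ['F_2]. *)

Require Import Defs.
From mathcomp Require Import all_boot all_order all_algebra.
From mathcomp Require Import qpoly zify ring.
Import GRing.Theory Num.Theory.
Set Implicit Arguments. Unset Strict Implicit. Unset Printing Implicit Defensive.
Local Open Scope ring_scope.

(** * Gaussian binomials and the finite q-binomial theorem *)

Lemma bin2S n : 'C(n.+1, 2) = ('C(n, 2) + n)%N.
Proof. by rewrite binS bin1. Qed.

Lemma bin2D n k : 'C(n + k, 2) = ('C(n, 2) + 'C(k, 2) + n * k)%N.
Proof.
by elim: k => [|k IHk]; rewrite ?addn0 ?muln0 ?addn0 // addnS !bin2S IHk; lia.
Qed.

Lemma bin2_double n : (2 * 'C(n, 2) + n = n ^ 2)%N.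
Proof. by elim: n => // n IHn; rewrite bin2S; lia. Qed.

Section QBinomial.
Variable A : comNzRingType.
Implicit Types (q x y z u v : A) (n k l N : nat).

Definition qpoch q n : A := \prod_(i < n) (1 - q ^+ i.+1).

(** The Gaussian binomial coefficient, defined by its Pascal rule so that it makes sense for
    nilpotent [q] too. *)
Fixpoint qbin q n k : A :=
  match n, k with
  | _, 0 => 1
  | 0, _.+1 => 0
  | n'.+1, k'.+1 => qbin q n' k' + q ^+ k * qbin q n' k
  end.

Lemma qpochS q n : qpoch q n.+1 = qpoch q n * (1 - q ^+ n.+1).
Proof. by rewrite /qpoch big_ord_recr. Qed.

Lemma qbinn0 q n : qbin q n 0 = 1. Proof. by case: n. Qed.

Lemma qbin_small q n k : (n < k)%N -> qbin q n k = 0.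
Proof.
elim: n k => [|n IHn] [|k] //=; rewrite ltnS => lt_nk.
by rewrite !IHn ?mulr0 ?addr0 // ltnW.
Qed.

(** Induction on [k + l]: the two Pascal terms contribute [1 - q ^+ k.+1] and
    [q ^+ k.+1 * (1 - q ^+ l.+1)] times [qpoch q n], and these add up to [qpoch q n.+1]. *)
Lemma qbin_qpoch q k l :
  qbin q (k + l) k * (qpoch q k * qpoch q l) = qpoch q (k + l).
Proof.
move Dn: (k + l)%N => n; elim: n k l Dn => [|n IHn] [|k] [|l] //.
- by move=> _; rewrite /qpoch !big_ord0 !mulr1.
- by move=> <-; rewrite qbinn0 mul1r /qpoch big_ord0 mul1r.
- rewrite addn0 => -[->] /=; have := IHn _ _ (addn0 n).
  rewrite (@qbin_small _ n n.+1) // !qpochS mulr0 addr0 => E1.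
  by rewrite -[in RHS]E1; ring.
rewrite addSnnS addnS => -[Dn] /=.
have E1 := IHn _ _ Dn.
have /IHn E2 : (k.+1 + l = n)%N by rewrite -Dn addSnnS.
rewrite [qpoch q n.+1]qpochS [LHS]mulrDl.
rewrite -[X in X * (1 - _)]mulr1 mulrBr mulr1.
have -> : qbin q n k * (qpoch q k.+1 * qpoch q l.+1)
          = qpoch q n * (1 - q ^+ k.+1) by rewrite -E1 (qpochS q k); ring.
have -> : q ^+ k.+1 * qbin q n k.+1 * (qpoch q k.+1 * qpoch q l.+1)
          = q ^+ k.+1 * qpoch q n * (1 - q ^+ l.+1).
  by rewrite -E2 (qpochS q l); ring.
by rewrite -Dn -addSn exprD; ring.
Qed.

(** Peeling off the factor [i = 0] leaves the same product with [z * q] for [z]; Pascal's rule then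
    matches the terms. *)
Lemma qbinomial q y z n :
  \prod_(i < n) (y + z * q ^+ i) =
  \sum_(k < n.+1) q ^+ 'C(k, 2) * qbin q n k * z ^+ k * y ^+ (n - k).
Proof.
elim: n z => [|n IHn] z.
  by rewrite big_ord0 big_ord_recl big_ord0 addr0 !mulr1.
rewrite big_ord_recl expr0 mulr1.
under eq_bigr => i _ do rewrite /= /bump /= add1n exprS mulrA.
rewrite {}IHn mulrDl [X in X + _]mulr_sumr [X in _ + X]mulr_sumr.
rewrite [RHS]big_ord_recl /= subn0 !mul1r.
under [X in _ = _ + X]eq_bigr => k _ do rewrite /= /bump /= add1n subSS mulrDr !mulrDl.
rewrite big_split /= [RHS]addrCA [LHS]addrC; congr (_ + _); last first.
  rewrite big_ord_recl /= subn0 qbinn0 !mul1r -exprS; congr (_ + _).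
  rewrite [RHS]big_ord_recr /= qbin_small // !(mulr0, mul0r) addr0.
  apply: eq_bigr => k _; rewrite /bump /= add1n exprMn.
  have -> : (n - k = (n - k.+1).+1)%N by have := ltn_ord k; lia.
  by rewrite [y ^+ _.+1]exprS; ring.
apply: eq_bigr => k _; rewrite bin2S exprD exprMn exprS; ring.
Qed.

(** * Inverting q-products when q is nilpotent *)

Section Nilpotent.
Variables (q : A) (N : nat).
Hypothesis qN0 : q ^+ N = 0.

Lemma expr_nil_ge i : (N <= i)%N -> q ^+ i = 0.
Proof. by move=> /subnK <-; rewrite exprD qN0 mulr0. Qed.

(** The difference [w = u - v] satisfies [w = q ^+ i * w]; iterating [N] times gives [w = 0]. *)
Lemma mulrI_1Bnil i u v :
  (0 < i)%N -> (1 - q ^+ i) * u = (1 - q ^+ i) * v -> u = v.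
Proof.
move=> i_gt0 /eqP; rewrite -subr_eq0 -mulrBr mulrBl mul1r subr_eq0 => /eqP Ew.
apply/eqP; rewrite -subr_eq0; apply/eqP; move: (u - v) Ew => w Ew.
have Ek k : w = q ^+ (i * k) * w.
  elim: k => [|k IHk]; first by rewrite muln0 mul1r.
  by rewrite mulnS exprD -mulrA -IHk.
by rewrite (Ek N) expr_nil_ge ?mul0r // leq_pmull.
Qed.

Lemma qpoch_mulrI n u v : qpoch q n * u = qpoch q n * v -> u = v.
Proof.
elim: n u v => [|n IHn] u v; first by rewrite /qpoch big_ord0 !mul1r.
by rewrite !qpochS -!mulrA => /IHn/mulrI_1Bnil; apply.
Qed.

Lemma qpoch_nil n : (N <= n)%N -> qpoch q n = qpoch q N.
Proof.
move=> /subnKC <-; elim: (n - N)%N => [|k IHk]; first by rewrite addn0.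
by rewrite addnS qpochS IHk expr_nil_ge ?subr0 ?mulr1 // ltnW // ltnS leq_addr.
Qed.

(** For [l >= N] the products [qpoch q l] and [qpoch q (k + l)] coincide and cancel in
    [qbin_qpoch]. *)
Lemma qbin_nil k l : (N <= l)%N -> qbin q (k + l) k * qpoch q k = 1.
Proof.
move=> leNl; apply: (@qpoch_mulrI N); rewrite mulr1.
rewrite -[RHS](@qpoch_nil (k + l)) ?(leq_trans leNl) ?leq_addl //.
by rewrite -qbin_qpoch -(qpoch_nil leNl); ring.
Qed.

End Nilpotent.

(* Euler's sum for the product of the [1 + x ^ (2 i + 1)]; here
   [qbin (x ^+ 2) (2 * N) k] plays the role of the inverse of
   [qpoch (x ^+ 2) k], see [qbin_nil]. *)
Lemma euler_odd_prod x N : x ^+ N = 0 ->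
  \prod_(i < 2 * N) (1 + x ^+ (2 * i).+1) =
  \sum_(k < N) x ^+ (k ^ 2) * qbin (x ^+ 2) (2 * N) k.
Proof.
move=> xN0; have := qbinomial (x ^+ 2) 1 x (2 * N).
under eq_bigr => i _ do rewrite -exprM -exprS.
move=> ->; under eq_bigr => k _.
  rewrite expr1n mulr1 -mulrA (mulrC (qbin _ _ _)) mulrA -exprM -exprD.
  rewrite bin2_double; over.
rewrite -(big_mkord xpredT (fun k => x ^+ (k ^ 2) * qbin (x ^+ 2) (2 * N) k)).
rewrite (big_cat_nat (n := N)) //= ?big_mkord; last lia.
rewrite [X in _ + X]big_nat [X in _ + X]big1 ?addr0 // => k /andP[leNk _].
by rewrite (expr_nil_ge xN0) ?mul0r //; nia.
Qed.

End QBinomial.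

(** * The Jacobi triple product, finite and truncated *)

(* With [l = k - n] in Z, this is [m l (l - 1) / 2 + a l]. *)
Definition theta_exp (m a n k : nat) : nat :=
  if (n <= k)%N then (m * 'C(k - n, 2) + a * (k - n))%N
  else (m * 'C(n - k, 2) + (m - a) * (n - k))%N.

(** The left side is the exponent of [X] in term [k] of the q-binomial theorem with [q = X^m],
    [z = X^a], [y = X^(m n)] and [2n] factors, the Gaussian binomial aside. *)
Lemma theta_expE m a n k : (a <= m)%N -> (k <= n + n)%N ->
  (m * 'C(k, 2) + a * k + m * n * (n + n - k) =
   m * 'C(n, 2) + a * n + m * n * n + theta_exp m a n k)%N.
Proof.
move=> le_am le_k2n; rewrite /theta_exp; case: leqP => [le_nk|/ltnW le_kn].
  have [l Dk] : exists l, (k = n + l)%N by exists (k - n)%N; lia.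
  have [p Dp] : exists p, (n + n - k = p)%N by exists (n + n - k)%N.
  have Dn : (n = l + p)%N by lia.
  by rewrite Dp Dk addKn bin2D {}Dn; ring.
have [p Dn] : exists p, (n = k + p)%N by exists (n - k)%N; lia.
have [b Dm] : exists b, (m = a + b)%N by exists (m - a)%N; lia.
have -> : (n + n - k = n + p)%N by lia.
rewrite Dn !addKn Dm addKn bin2D.
have := bin2_double p; move: ('C(p, 2)) => c Dc.
have : ((a + b) * (2 * c + p) = (a + b) * p ^ 2)%N by rewrite Dc.
nia.
Qed.

(** The q-binomial theorem for the product of [X^(m n) + X^(a + m i)], [i < 2n]. The lower half
    gives the factors with [m - a] after reversing the index, the upper half those with [a]; the
    power of [X] pulled out is cancelled, hence the integral domain. *)
Lemma jacobi_triple_poly (R : idomainType) m a n : (a <= m)%N ->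
  (\prod_(i < n) (1 + 'X^(m * i + a))) * (\prod_(i < n) (1 + 'X^(m * i + (m - a))))
  = \sum_(k < (n + n).+1) 'X^(theta_exp m a n k) * qbin 'X^m (n + n) k
  :> {poly R}.
Proof.
move=> le_am.
have X_neq0 e : 'X^e != 0 :> {poly R} by rewrite expf_neq0 ?polyX_eq0.
apply: (mulfI (X_neq0 (m * 'C(n, 2) + a * n + m * n * n)%N)).
transitivity (\prod_(i < n + n) ('X^(m * n) + 'X^a * 'X^m ^+ i : {poly R})).
  rewrite big_split_ord /=.
  have -> : \prod_(i < n) ('X^(m * n) + 'X^a * 'X^m ^+ i) =
     'X^(m * 'C(n, 2) + a * n) * \prod_(i < n) (1 + 'X^(m * i + (m - a))) :> {poly R}.
    rewrite -[in RHS](big_mkord xpredT (fun i => 1 + 'X^(m * i + (m - a)))).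
    rewrite big_nat_rev big_mkord /=.
    have -> : 'X^(m * 'C(n, 2) + a * n) = \prod_(i < n) 'X^(m * i + a) :> {poly R}.
      elim: n => [|n IHn]; first by rewrite big_ord0 muln0 muln0.
      by rewrite big_ord_recr /= -IHn -exprD bin2S; congr 'X^_; lia.
    rewrite -big_split; apply: eq_bigr => i _ /=.
    rewrite -exprM -exprD mulrDr mulr1 -exprD addrC (addnC a); congr (_ + 'X^_).
    by have := ltn_ord i; nia.
  have -> : \prod_(i < n) ('X^(m * n) + 'X^a * 'X^m ^+ (n + i)%N) =
     'X^(m * n * n) * \prod_(i < n) (1 + 'X^(m * i + a)) :> {poly R}.
    have -> : 'X^(m * n * n) = \prod_(i < n) 'X^(m * n) :> {poly R}.
      by rewrite prodr_const card_ord exprM.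
    rewrite -big_split.
    apply: eq_bigr => i _ /=; rewrite mulrDr mulr1 -!exprM -!exprD.
    by congr (_ + 'X^_); lia.
  by rewrite exprD; ring.
rewrite qbinomial mulr_sumr; apply: eq_bigr => k _.
rewrite -!exprM mulrA -exprD -theta_expE // -1?ltnS //.
by rewrite !exprD; ring.
Qed.

Lemma rmorph_qbin (A B : comNzRingType) (f : {rmorphism A -> B}) q n k :
  f (qbin q n k) = qbin (f q) n k.
Proof.
elim: n k => [|n IHn] [|k] /=; rewrite ?rmorph0 ?rmorph1 //.
by rewrite rmorphD rmorphM rmorphXn !IHn.
Qed.

(** A nilpotent [x] cannot be cancelled, so the identity is taken over [{poly int}] and specialised
    at [x]. *)
Lemma jacobi_triple_finite (A : comNzRingType) (x : A) m a n : (a <= m)%N ->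
  (\prod_(i < n) (1 + x ^+ (m * i + a))) *
  (\prod_(i < n) (1 + x ^+ (m * i + (m - a))))
  = \sum_(k < (n + n).+1) x ^+ theta_exp m a n k * qbin (x ^+ m) (n + n) k.
Proof.
move=> le_am.
pose f : {rmorphism {poly int} -> A} := horner_eval x \o map_poly intr.
have fX e : f 'X^e = x ^+ e.
  by rewrite /f /= map_polyXn /horner_eval hornerXn.
have /(congr1 f) := jacobi_triple_poly int n le_am.
rewrite rmorphM !rmorph_prod rmorph_sum.
under eq_bigr => i _ do rewrite rmorphD rmorph1 fX.
under [X in _ * X]eq_bigr => i _ do rewrite rmorphD rmorph1 fX.
move=> ->; apply: eq_bigr => k _.
by rewrite rmorphM rmorph_qbin !fX.
Qed.

(** For [N <= k <= 3 * N], [qbin_nil] makes [qpoch] times [qbin] equal to 1; for the other [k] the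
    exponent is at least [N] and both terms vanish. *)
Lemma jacobi_triple_nil (A : comNzRingType) (x : A) N m a :
  (0 < a < m)%N -> x ^+ N = 0 ->
  qpoch (x ^+ m) N *
    ((\prod_(i < 2 * N) (1 + x ^+ (m * i + a))) *
     (\prod_(i < 2 * N) (1 + x ^+ (m * i + (m - a)))))
  = \sum_(k < (4 * N).+1) x ^+ theta_exp m a (2 * N) k.
Proof.
move=> /andP[a_gt0 lt_am] xN0; rewrite jacobi_triple_finite ?(ltnW lt_am) //.
rewrite mulr_sumr (_ : 2 * N + 2 * N = 4 * N)%N; last lia.
apply: eq_bigr => k _.
have [/andP[leNk lek3N]|] := boolP (N <= k <= 3 * N)%N; last first.
  have lek4N : (k <= 4 * N)%N by rewrite -ltnS.
  move=> far; rewrite [x ^+ theta_exp _ _ _ _](expr_nil_ge xN0) ?mul0r ?mulr0 //.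
  rewrite /theta_exp; case: (leqP (2 * N) k) => cmp; apply: leq_trans (leq_addl _ _).
    by apply: leq_trans (leq_pmull _ a_gt0); lia.
  by apply: leq_trans (leq_pmull _ _); lia.
have qN0 : (x ^+ m) ^+ N = 0.
  by rewrite -exprM (expr_nil_ge xN0) // leq_pmull // (leq_trans _ lt_am).
have := qbin_nil qN0 k (l := (4 * N - k)%N).
rewrite subnKC -1?ltnS // (qpoch_nil qN0 leNk) => E.
by rewrite mulrCA (mulrC (qpoch _ _)) E ?mulr1 //; lia.
Qed.

(** * Product identities in characteristic 2 *)

Definition c3_part (j k : nat) : bool :=
  [|| odd k, k <= 2 * j | (4 %| k) && (4 * j + 4 <= k)]%N.

Section Char2.
Variables (A : comNzRingType) (x : A) (N : nat).
Hypothesis (A2 : 2%N \in [pchar A]) (xN0 : x ^+ N = 0).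

Lemma prod_ord_mul2 (f : nat -> A) K :
  \prod_(i < 2 * K) f i = \prod_(i < K) (f (2 * i)%N * f (2 * i).+1).
Proof.
elim: K => [|K IHK]; first by rewrite muln0 !big_ord0.
by rewrite mulnS !big_ord_recr /= IHK mulrA.
Qed.

Lemma prod_ord_mul3 (f : nat -> A) K :
  \prod_(i < 3 * K) f i =
  \prod_(i < K) (f (3 * i)%N * f (3 * i).+1 * f (3 * i).+2).
Proof.
elim: K => [|K IHK]; first by rewrite muln0 !big_ord0.
by rewrite mulnS !big_ord_recr /= IHK !mulrA.
Qed.

Lemma prod_ord_stable (f : nat -> A) m n :
  (forall i, (minn m n <= i)%N -> f i = 1) ->
  \prod_(i < m) f i = \prod_(i < n) f i.
Proof.
wlog le_mn : m n / (m <= n)%N => [Hw Hf|].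
  case/orP: (leq_total m n) => le; first exact: Hw.
  by apply/esym/Hw => // i; rewrite minnC; apply: Hf.
rewrite (minn_idPl le_mn) => Hf.
rewrite -!(big_mkord xpredT f) [RHS](big_cat_nat (n := m)) //=.
rewrite [X in _ * X]big_nat [X in _ * X]big1 ?mulr1 // => i /andP[le_mi _].
exact: Hf.
Qed.

Lemma prod_1D_stable (e : nat -> nat) m n : (forall i, i <= e i)%N ->
  (N <= m)%N -> (N <= n)%N ->
  \prod_(i < m) (1 + x ^+ e i) = \prod_(i < n) (1 + x ^+ e i).
Proof.
move=> le_e leNm leNn; apply: (prod_ord_stable (f := fun i => 1 + x ^+ e i)).
move=> i; rewrite geq_min => le_i; rewrite (expr_nil_ge xN0) ?addr0 //.
by apply: leq_trans (le_e i); case/orP: le_i; apply: leq_trans.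
Qed.

Lemma qpoch_char2 q K : qpoch q K = \prod_(i < K) (1 + q ^+ i.+1) :> A.
Proof. by apply: eq_bigr => i _; rewrite oppr_pchar2. Qed.

Lemma qpochX d K : qpoch (x ^+ d) K = \prod_(i < K) (1 + x ^+ (d * i.+1)).
Proof. by rewrite qpoch_char2; apply: eq_bigr => i _; rewrite exprM. Qed.

Lemma sqrr_1D u : (1 + u) ^+ 2 = 1 + u ^+ 2 :> A.
Proof. by rewrite sqrrD expr1n mul1r mulr2n addrr_pchar2 ?addr0. Qed.

Definition odd_prod : A := \prod_(i < 2 * N) (1 + x ^+ (2 * i).+1).

(** The exponents [4 i + 1] and [4 i + 3] together run over the odd numbers. *)
Lemma odd_prod_qpoch4 :
  odd_prod * qpoch (x ^+ 4) N =
  \sum_(k < (4 * N).+1) x ^+ theta_exp 4 3 (2 * N) k.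
Proof.
rewrite -(jacobi_triple_nil _ xN0) // mulrC; congr (_ * _).
rewrite -big_split /odd_prod /=.
rewrite (prod_1D_stable (e := fun i => (2 * i).+1) (m := 2 * N) (n := 2 * (2 * N))); [|lia..].
rewrite (prod_ord_mul2 (fun i => 1 + x ^+ (2 * i).+1)).
by apply: eq_bigr => i _; rewrite mulrC; congr ((1 + x ^+ _) * (1 + x ^+ _)); lia.
Qed.

(** Both sides are the product of all [1 + x^(2 k)]: on the left the squares give the exponents
    [4 i + 2] and [qpoch] the [4 i + 4]; on the right [6 i + 2], [6 i + 4] and [6 i + 6] exhaust the
    even numbers. *)
Lemma odd_prod_sqr_qpoch4 :
  odd_prod ^+ 2 * qpoch (x ^+ 4) N =
  \sum_(k < (4 * N).+1) x ^+ theta_exp 6 4 (2 * N) k.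
Proof.
rewrite -(jacobi_triple_nil _ xN0) // -big_split /=.
have qN0 d : (0 < d)%N -> (x ^+ d) ^+ N = 0.
  by move=> d_gt0; rewrite -exprM (expr_nil_ge xN0) // leq_pmull.
rewrite -!(qpoch_nil (qN0 _ _) (n := 2 * N)) //; try lia.
rewrite !qpochX -big_split /odd_prod /= expr2 -!big_split /=.
transitivity (\prod_(i < 2 * (2 * N)) (1 + x ^+ (2 * i).+2)).
  rewrite (prod_ord_mul2 (fun i => 1 + x ^+ (2 * i).+2)).
  apply: eq_bigr => i _; rewrite -expr2 sqrr_1D -exprM.
  by congr ((1 + x ^+ _) * (1 + x ^+ _)); lia.
rewrite (prod_1D_stable (e := fun i => (2 * i).+2) (m := 2 * (2 * N)) (n := 3 * (2 * N))); [|lia..].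
rewrite (prod_ord_mul3 (fun i => 1 + x ^+ (2 * i).+2)).
apply: eq_bigr => i _; rewrite [LHS]mulrC [X in _ * X = _]mulrC.
by congr ((1 + x ^+ _) * ((1 + x ^+ _) * (1 + x ^+ _))); lia.
Qed.

Definition c3_factor j k : A := if c3_part j k then 1 + x ^+ k else 1.

(** Multiplying by [qpoch (x ^+ 2) j] squares the factors of the even parts up to [2 j], turning
    [1 + x^(2 k)] into [1 + x^(4 k)]; the parts [4 k] with [k > j] complete [qpoch (x ^+ 4) N]. *)
Lemma c3_factor_prod j : (j < N)%N ->
  (\prod_(i < N.-1) c3_factor j i.+1) * qpoch (x ^+ 2) j
  = odd_prod * qpoch (x ^+ 4) N.
Proof.
move=> lt_jN.
have factor1 i : (N.-1 <= i)%N -> c3_factor j i.+1 = 1.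
  rewrite /c3_factor => le_i; rewrite (expr_nil_ge xN0) ?addr0 ?if_same //; lia.
rewrite (prod_ord_stable (f := fun i => c3_factor j i.+1) (n := 2 * (2 * N)));
  last by move=> i le_i; apply: factor1; lia.
rewrite (prod_ord_mul2 (fun i => c3_factor j i.+1)) big_split /= -mulrA.
congr (_ * _).
  apply: eq_bigr => i _; rewrite /c3_factor /c3_part.
  by rewrite ifT //; apply/orP; left; lia.
have -> : \prod_(i < 2 * N) c3_factor j (2 * i).+2 =
  qpoch (x ^+ 2) j * \prod_(i < N) (if (j <= i)%N then 1 + x ^+ (4 * i.+1) else 1).
  rewrite qpochX (big_ord_widen_cond (2 * N) xpredT (fun i => 1 + x ^+ (2 * i.+1))) /=; last lia.
  rewrite [X in _ = X * _]big_mkcond /=.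
  (* Reindexed over the even parts [2 (i + 1)]: the multiples of 4 are those with [i] odd. *)
  have -> : \prod_(i < N) (if (j <= i)%N then 1 + x ^+ (4 * i.+1) else 1) =
    \prod_(i < 2 * N) (if (odd i && (2 * j < i)%N) then 1 + x ^+ (2 * i.+1) else 1).
    rewrite (prod_ord_mul2 (fun i => if (odd i && (2 * j < i)%N) then 1 + x ^+ (2 * i.+1) else 1)).
    apply: eq_bigr => i _; rewrite oddM /= mul1r oddM /= ltnS leq_pmul2l //.
    by case: ifP => // _; congr (1 + x ^+ _); lia.
  rewrite -big_split; apply: eq_bigr => i _ /=.
  rewrite /c3_factor /c3_part mulnS !add2n.
  have -> : odd (2 * i).+2 = false by rewrite /= oddM.
  have -> /= : ((4 %| (2 * i).+2) && (4 * j + 4 <= (2 * i).+2))%N = odd i && (2 * j < i)%N.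
    by lia.
  have -> : ((2 * i).+2 <= 2 * j)%N = (i < j)%N by lia.
  have [lt_ij|_] := ltnP i j; last by rewrite mul1r.
  by rewrite ifF ?mulr1 //; lia.
rewrite mulrAC -expr2 qpochX expr2 -big_split /=.
under eq_bigr => i _ do rewrite -expr2 sqrr_1D -exprM mulnAC.
rewrite (big_ord_widen_cond N xpredT (fun i => 1 + x ^+ (2 * 2 * i.+1))) ?(ltnW lt_jN) //.
rewrite [X in X * _]big_mkcond qpochX -big_split; apply: eq_bigr => i _ /=.
by case: ltnP => _; rewrite ?mul1r ?mulr1.
Qed.

(** The two multiplicities allowed for the part 1 give [x^(j^2) (1 + x)], and [1 + x] is the factor
    [i = 0] absent from the product, so [c3_factor_prod] applies. *)
Lemma c3_series_theta :
  \sum_(1 <= j < N) (x ^+ (j ^ 2) + x ^+ (j ^ 2).+1) *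
     \prod_(1 <= i < N.-1) c3_factor j i.+1 =
  \sum_(k < (4 * N).+1) x ^+ theta_exp 6 4 (2 * N) k +
  \sum_(k < (4 * N).+1) x ^+ theta_exp 4 3 (2 * N) k.
Proof.
rewrite -odd_prod_sqr_qpoch4 -odd_prod_qpoch4 -mulrDl expr2.
rewrite -[X in _ + X]mulr1 -mulrDr.
under eq_big_nat => j /andP[j_gt0 lt_jN].
  have -> : (x ^+ (j ^ 2) + x ^+ (j ^ 2).+1) *
       \prod_(1 <= i < N.-1) c3_factor j i.+1 =
     odd_prod * qpoch (x ^+ 4) N * (x ^+ (j ^ 2) * qbin (x ^+ 2) (2 * N) j).
    rewrite -(c3_factor_prod lt_jN) -mulrA (mulrC (qpoch _ _)) -!mulrA.
    have qN0 : (x ^+ 2) ^+ N = 0.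
      by rewrite -exprM (expr_nil_ge xN0) // leq_pmull.
    have := qbin_nil qN0 j (l := (2 * N - j)%N).
    rewrite subnKC; last lia.
    move=> -> //; last lia; rewrite mulr1 [RHS]mulrC.
    have -> : x ^+ (j ^ 2) + x ^+ (j ^ 2).+1 = x ^+ (j ^ 2) * (1 + x).
      by rewrite mulrDr mulr1 -exprSr.
    rewrite -mulrA; congr (_ * _).
    rewrite -(big_mkord xpredT (fun i => c3_factor j i.+1)).
    by rewrite [RHS]big_ltn //; lia.
  over.
rewrite -mulr_sumr [RHS]mulrAC; congr (_ * _).
rewrite /odd_prod euler_odd_prod // -(big_mkord xpredT (fun k => x ^+ (k ^ 2) * qbin (x ^+ 2) (2 * N) k)).
have N_gt0 : (0 < N)%N.
  by case: N xN0 => // /eqP; rewrite expr0 oner_eq0.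
(* The term [k = 0] of Euler's sum is 1 and cancels the added 1. *)
rewrite [X in _ = X + _]big_ltn // expr0 mul1r qbinn0 addrAC addrr_pchar2 //.
by rewrite add0r.
Qed.
End Char2.

(** * The generating polynomial of [c3] *)

(* The index [i] stands for the part [i + 1]. *)
Definition c3_mult (n j : nat) (i : 'I_n) (v : 'I_n.+1) : bool :=
  if i == 0%N :> nat then (v == j ^ 2 :> nat)%N || (v == (j ^ 2).+1 :> nat)
  else (v <= 1)%N && ((0 < v)%N ==> c3_part j i.+1).

(** For fixed [j] the conditions bear on each multiplicity separately; [family] is the index set
    that arises from expanding a product of sums. *)
Lemma c3_cond_j_family n (m : {ffun 'I_n -> 'I_n.+1}) j : (0 < n)%N ->
  c3_cond_j m j = (0 < j)%N && (m \in family (fun i => c3_mult j i)).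
Proof.
case: n m => // n m _; rewrite /c3_cond_j; congr (_ && _).
have -> : mult m 1 = m ord0.
  rewrite /mult /= insubT //=; congr (nat_of_ord (m _)).
  exact: val_inj.
apply/and4P/familyP => [[m1 /forallP odd1 /forallP even1 /forallP evenP] i | fam].
  rewrite unfold_in /c3_mult.
  case: eqVneq => [i0|i_neq0].
    by rewrite (_ : i = ord0) //; apply: val_inj.
  have := odd1 i; have := even1 i; have := evenP i; rewrite /c3_part.
  have -> : (1 < i.+1)%N by rewrite ltnS lt0n.
  rewrite andbT.
  by case: (odd i.+1); case: (m i <= 1)%N; case: (0 < m i)%N.
have fam0 := fam ord0; rewrite unfold_in /= in fam0.
have famS (i : 'I_n.+1) : (0 < i)%N -> (m i <= 1)%N && ((0 < m i)%N ==> c3_part j i.+1).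
  by rewrite lt0n => /negbTE i_neq0; have := fam i; rewrite unfold_in /c3_mult i_neq0.
have leP (i : 'I_n.+1) : (0 < i)%N -> (m i <= 1)%N by case/famS/andP.
split=> //; apply/forallP => i; have [i0|i_gt0] := posnP i;
  try by [rewrite i0 | rewrite leP ?implybT].
have /andP[_] := famS i i_gt0; rewrite /c3_part.
by case: (odd i.+1); case: (0 < m i)%N.
Qed.

Lemma has_sum_uniq (T : eqType) (s : seq T) (p : pred T) : uniq s ->
  {in s &, forall i j, p i -> p j -> i = j} ->
  nat_of_bool (has p s) = (\sum_(i <- s) p i)%N.
Proof.
move=> uniq_s p_inj; case: hasP => [[i si pi]|no].
  rewrite (bigD1_seq i) //= pi big_seq_cond big1 // => k /andP[sk ki].
  by case: (boolP (p k)) => // pk; rewrite (p_inj k i) ?eqxx in ki.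
rewrite big_seq big1 // => i si; case: (boolP (p i)) => // pi.
by case: no; exists i.
Qed.

(** For [k >= 1], [(k + 1)^2 > k^2 + 1]; at [k = 0] the two would collide. *)
Lemma sqr_or_succ_inj i j a : (0 < i)%N -> (0 < j)%N ->
  (a == i ^ 2)%N || (a == (i ^ 2).+1) -> (a == j ^ 2)%N || (a == (j ^ 2).+1) ->
  i = j.
Proof.
have no_lt k l : (0 < k)%N -> (k < l)%N ->
    (a <= (k ^ 2).+1)%N -> (l ^ 2 <= a)%N -> False.
  move=> k_gt0 lt_kl le_ak le_la.
  have : (k.+1 ^ 2 <= l ^ 2)%N by rewrite leq_exp2r.
  by rewrite -addn1 sqrnD; lia.
move=> i_gt0 j_gt0 Hi Hj; case: (ltngtP i j) => // [/no_lt|/no_lt] H; exfalso.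
  by apply: H => //; lia.
by apply: H => //; lia.
Qed.

Lemma c3_cond_sum n (m : {ffun 'I_n -> 'I_n.+1}) :
  nat_of_bool (c3_cond m) = (\sum_(1 <= j < n.+1) c3_cond_j m j)%N.
Proof.
rewrite /c3_cond has_sum_uniq ?iota_uniq //; last first.
  move=> i j _ _ /and5P[i_gt0 Hi _ _ _] /and5P[j_gt0 Hj _ _ _].
  exact: sqr_or_succ_inj Hi Hj.
by rewrite /index_iota subSS subn0.
Qed.

Section GeneratingPolynomial.
Variable R : comNzRingType.

Definition c3_poly n : {poly R} :=
  \sum_(1 <= j < n.+1) \prod_(i < n) \sum_(v | c3_mult j i v) 'X^(i.+1 * v).

(** Expanding the product of sums gives one monomial per multiplicity function, its exponent being
    the size; uniqueness of [j] prevents double counting. *)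
Lemma coef_c3_poly n : (0 < n)%N -> (c3_poly n)`_n = (c3 n)%:R.
Proof.
move=> n_gt0; rewrite /c3 cardsE -sum1_card big_mkcond /= /c3_poly coef_sum.
transitivity (\sum_(1 <= j < n.+1) \sum_(m : {ffun 'I_n -> 'I_n.+1})
   (is_partition_of m && c3_cond_j m j)%:R : R).
  apply: eq_big_nat => j /andP[j_gt0 _].
  rewrite bigA_distr_big_dep coef_sum big_mkcond; apply: eq_bigr => m _ /=.
  rewrite c3_cond_j_family // j_gt0 /= andbC.
  case: ifP => _ //=.
  have -> : \prod_(i < n) 'X^(i.+1 * m i) = 'X^(\sum_(i < n) (i.+1 * m i)) :> {poly R}.
    by apply/esym/big_morph => // a b; rewrite exprD.
  by rewrite coefXn eq_sym.
rewrite exchange_big natr_sum; apply: eq_bigr => m _ /=.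
rewrite -topredE /=; case: (is_partition_of m) => /=; last by rewrite big1.
by rewrite -natr_sum -c3_cond_sum; case: (c3_cond m).
Qed.
End GeneratingPolynomial.

Lemma sum_ord_nil_eq (A : comNzRingType) (x : A) N a : x ^+ N = 0 ->
  \sum_(v < N | v == a :> nat) x ^+ v = x ^+ a.
Proof.
move=> xN0; have [lt_aN|le_Na] := ltnP a N.
  by rewrite (big_pred1 (Ordinal lt_aN)).
rewrite big_pred0 ?(expr_nil_ge xN0) // => v.
by apply/negbTE; rewrite neq_ltn (leq_trans (ltn_ord v)).
Qed.

Lemma rmorph_c3_poly (R A : comNzRingType) (f : {rmorphism {poly R} -> A}) n :
  (0 < n)%N -> f 'X ^+ n.+1 = 0 ->
  f (c3_poly R n) =
  \sum_(1 <= j < n.+1) (f 'X ^+ (j ^ 2) + f 'X ^+ (j ^ 2).+1) *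
     \prod_(1 <= i < n) c3_factor (f 'X) j i.+1.
Proof.
move=> n_gt0; set x := f 'X => xN0.
rewrite rmorph_sum; apply: eq_bigr => j _; rewrite rmorph_prod.
case: n n_gt0 xN0 => // n _ xN0.
rewrite big_ord_recl big_add1 big_mkord /=; congr (_ * _).
  rewrite rmorph_sum /= /c3_mult /=.
  under eq_bigr => v _ do rewrite mul1n rmorphXn -/x.
  rewrite -!(sum_ord_nil_eq _ xN0) big_mkcond.
  rewrite [X in _ = X + _]big_mkcond [X in _ = _ + X]big_mkcond -big_split.
  apply: eq_bigr => v _ /=; case: eqP => [->|_] /=; last by rewrite add0r.
  by rewrite ifF ?addr0 //; lia.
apply: eq_bigr => i _; rewrite rmorph_sum /=.
under eq_bigr => v _ do rewrite rmorphXn -/x.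
(* Only the multiplicities 0 and 1 survive. *)
rewrite big_mkcond !big_ord_recl big1 => [|v _]; last by rewrite /c3_mult.
rewrite /c3_mult /c3_factor /= addr0 muln0 muln1 /bump /= !add1n.
by case: ifP; rewrite ?addr0.
Qed.

(** * Coefficients modulo [X^(n + 1)] and the two theta series *)

Lemma in_qpolyXn_eq0 (R : nzRingType) n : in_qpoly ('X^(n.+1) : {poly R}) 'X^(n.+1) = 0.
Proof. by apply: val_inj; rewrite /= mk_monic_Xn Pdiv.RingMonic.rmodpp ?monicXn. Qed.

Lemma coef_in_qpolyXn (R : nzRingType) n i (p : {poly R}) : (i <= n)%N ->
  (in_qpoly ('X^(n.+1)) p)`_i = p`_i.
Proof.
move=> le_in; rewrite /= mk_monic_Xn.
rewrite {2}(Pdiv.RingMonic.rdivp_eq (monicXn R n.+1) p).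
by rewrite coefD coefMXn ltnS le_in add0r.
Qed.

Lemma theta_exp64E n k :
  (theta_exp 6 4 n k)%:Z = (k%:Z - n%:Z) * (3 * (k%:Z - n%:Z) + 1).
Proof.
rewrite /theta_exp; case: leqP => [le_nk|/ltnW le_kn].
  have := bin2_double (k - n); have : (k = n + (k - n))%N by lia.
  by move: (k - n)%N => l -> /=; rewrite -mulnn; nia.
have := bin2_double (n - k); have : (n = k + (n - k))%N by lia.
by move: (n - k)%N => l -> /=; rewrite -mulnn; nia.
Qed.

Lemma theta_exp43E n k :
  (theta_exp 4 3 n k)%:Z = (k%:Z - n%:Z) * (2 * (k%:Z - n%:Z) + 1).
Proof.
rewrite /theta_exp; case: leqP => [le_nk|/ltnW le_kn].
  have := bin2_double (k - n); have : (k = n + (k - n))%N by lia.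
  by move: (k - n)%N => l -> /=; rewrite -mulnn; nia.
have := bin2_double (n - k); have : (n = k + (n - k))%N by lia.
by move: (n - k)%N => l -> /=; rewrite -mulnn; nia.
Qed.

(** The difference of two values is [(l - l') (d (l + l') + 1)], and a zero second factor would make
    [d] divide 1. *)
Lemma pronic_inj (d : int) : d != 0 -> ~~ (d %| 1)%Z ->
  injective (fun l : int => l * (d * l + 1)).
Proof.
move=> d_neq0 d_ndvd1 l l' /= E.
have /eqP : (l - l') * (d * (l + l') + 1) = 0.
  transitivity (l * (d * l + 1) - l' * (d * l' + 1)); first by ring.
  by rewrite E subrr.
rewrite mulf_eq0 subr_eq0 => /orP[/eqP //|/eqP E0].
case/negP: d_ndvd1; apply/dvdzP; exists (- (l + l')).
by move: E0; lia.
Qed.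

Lemma coef_sum_Xn_inj (R : nzRingType) (I : finType) (e : I -> nat) n :
  injective e ->
  (\sum_i 'X^(e i) : {poly R})`_n = [exists i, e i == n]%:R.
Proof.
move=> e_inj; rewrite coef_sum.
case: existsP => [[i /eqP <-]|no].
  rewrite (bigD1 i) //= coefXn eqxx big1 ?addr0 // => k k_neq_i.
  by rewrite coefXn (inj_eq e_inj) eq_sym (negbTE k_neq_i).
rewrite big1 // => i _; rewrite coefXn; case: eqP => // Ei.
by case: no; exists i; rewrite -Ei.
Qed.

Lemma natr_F2 a : (a%:R : 'F_2) = (odd a)%:R.
Proof. by apply: val_inj; rewrite /= !val_Fp_nat //= !modn2; case: odd. Qed.

(** Since [d >= 2] forces [|l| <= |l (d l + 1)| = n], the finite range of indices misses no [l]. *)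
Lemma pronic_theta (d : int) (e : nat -> nat -> nat) n : 2 <= d ->
  (forall M k, (e M k)%:Z = (k%:Z - M%:Z) * (d * (k%:Z - M%:Z) + 1)) ->
  [exists k : 'I_(4 * n.+1).+1, e (2 * n.+1)%N k == n] <->
  exists l : int, n%:Z = l * (d * l + 1).
Proof.
move=> d_ge2 eE; split=> [/existsP[k /eqP <-]|[l Dn]].
  by rewrite eE; eexists.
have le_l : `|l| <= n%:Z by nia.
have lt_k : (absz (l + (2 * n.+1)%:Z)%R < (4 * n.+1).+1)%N by lia.
apply/existsP; exists (Ordinal lt_k); apply/eqP.
have /= := eE (2 * n.+1)%N (Ordinal lt_k).
have -> : (absz (l + (2 * n.+1)%:Z))%:Z - (2 * n.+1)%:Z = l by lia.
by rewrite -Dn => -[].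
Qed.

(** Coefficients of [X^n] are compared modulo [X^(n + 1)] over ['F_2]; by [pronic_inj] each theta
    series has coefficient 0 or 1 there. *)
Lemma c3_odd n : (0 < n)%N -> exists b1 b2 : bool,
  [/\ odd (c3 n) = b1 (+) b2,
      b1 <-> exists l : int, n%:Z = l * (3 * l + 1)
    & b2 <-> exists l : int, n%:Z = l * (2 * l + 1)].
Proof.
move=> n_gt0.
pose M := (2 * n.+1)%N.
exists [exists k : 'I_(4 * n.+1).+1, theta_exp 6 4 M k == n].
exists [exists k : 'I_(4 * n.+1).+1, theta_exp 4 3 M k == n].
split; [| exact: pronic_theta theta_exp64E | exact: pronic_theta theta_exp43E].
pose h : {poly 'F_2} := 'X^(n.+1).
pose x : {poly %/ h} := in_qpoly h 'X.
have xN0 : x ^+ n.+1 = 0 by rewrite /x -rmorphXn; apply: in_qpolyXn_eq0.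
have A2 : 2%N \in [pchar {poly %/ h}] by rewrite pchar_qpoly pchar_Fp.
have fX e : in_qpoly h 'X^e = x ^+ e by rewrite rmorphXn.
have := c3_series_theta A2 xN0.
rewrite -(rmorph_c3_poly (f := in_qpoly h)) //.
under eq_bigr => k _ do rewrite -fX.
under [X in _ + X]eq_bigr => k _ do rewrite -fX.
rewrite -!rmorph_sum -rmorphD => /(congr1 (fun p : {poly %/ h} => (p : {poly 'F_2})`_n)).
have coefh p : (in_qpoly h p)`_n = p`_n by exact: coef_in_qpolyXn.
rewrite !coefh coef_c3_poly // coefD.
have inj64 : injective (fun k : 'I_(4 * n.+1).+1 => theta_exp 6 4 M k).
  move=> k k' /(congr1 Posz); rewrite !theta_exp64E => /pronic_inj E.
  by have /addIr[] := E isT isT => /val_inj.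
have inj43 : injective (fun k : 'I_(4 * n.+1).+1 => theta_exp 4 3 M k).
  move=> k k' /(congr1 Posz); rewrite !theta_exp43E => /pronic_inj E.
  by have /addIr[] := E isT isT => /val_inj.
rewrite !coef_sum_Xn_inj // natr_F2.
by case: odd; case: [exists _, _]; case: [exists _, _].
Qed.

(** * Quadratic forms and residues modulo 5 *)

Lemma triangular_pronic (n : nat) :
  (exists l : int, n%:Z = l * (2 * l + 1)) <->
  exists j : nat, (2 * n = j * (j + 1))%N.
Proof.
split=> [[[l|l] Dn]|[j Dn]].
(* As [2 n = 2 l (2 l + 1)], [j] is [2 l] for [l >= 0] and [- 2 l - 1] for [l < 0]. *)
- by exists (2 * l)%N; nia.
- by exists (2 * l).+1; nia.
have [j_odd|j_even] := boolP (odd j).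
  exists (- (j./2.+1)%:Z); have : (j = 2 * j./2 + 1)%N by lia.
  by move: (j./2) => i Dj; nia.
exists (j./2)%:Z; have : (j = 2 * j./2)%N by lia.
by move: (j./2) => i Dj; nia.
Qed.

Lemma int_mod5 (l : int) : exists a : int,
  l = 5 * a \/ l = 5 * a + 1 \/ l = 5 * a + 2 \/ l = 5 * a + 3 \/ l = 5 * a + 4.
Proof. by exists (l %/ 5)%Z; lia. Qed.

Local Close Scope ring_scope.

Theorem theorem3 (n : nat) :
  [/\ (odd (c3 (5 * n + 1)) <->
         exists j : nat, [/\ 1 <= j, 10 * n + 2 = j * (j + 1)
                           & (j %% 5 == 1) || (j %% 5 == 3)]),
      (odd (c3 (5 * n + 2)) <->
         exists j : int, (Posz (5 * n + 2) = (5 * j + 4) * (15 * j + 13))%R),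
      (odd (c3 (5 * n + 3)) <->
         exists j : nat, 10 * n + 6 = (5 * j + 2) * (5 * j + 3))
    & (odd (c3 (5 * n + 4)) <->
         exists j : int, (Posz (5 * n + 4) = j * (3 * j + 1))%R /\
                         (((j %% 5)%Z == 1%Z) || ((j %% 5)%Z == 2%Z)))].
Proof.
(* When one representation is impossible, the exclusive or reduces to the other. *)
have odd_iff (b1 b2 : bool) (P1 P2 : Prop) : (b1 <-> P1) -> (b2 <-> P2) ->
    (~ P1 -> (b1 (+) b2 <-> P2)) /\ (~ P2 -> (b1 (+) b2 <-> P1)).
  by case: b1; case: b2; intuition.
split.
- have [|b1 [b2 [-> E1 E2]]] := @c3_odd (5 * n + 1); first lia.
  have no : ~ exists l : int, (Posz (5 * n + 1) = l * (3 * l + 1))%R.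
    by move=> [l]; have [a] := int_mod5 l; case=> [|[|[|[|]]]] ->; nia.
  have [/(_ no) -> _] := odd_iff _ _ _ _ E1 E2.
  rewrite triangular_pronic; split=> [[j Dj]|[j [_ Dj _]]]; last by exists j; lia.
  (* [j (j + 1)] is 2 modulo 5 only for [j] equal to 1 or 3 modulo 5. *)
  exists j; split; [nia|lia|].
  have : j = 5 * (j %/ 5) + j %% 5 by lia.
  have : j %% 5 < 5 by rewrite ltn_mod.
  move: (j %/ 5) (j %% 5) => a r; nia.
- have [|b1 [b2 [-> E1 E2]]] := @c3_odd (5 * n + 2); first lia.
  have no : ~ exists l : int, (Posz (5 * n + 2) = l * (2 * l + 1))%R.
    by move=> [l]; have [a] := int_mod5 l; case=> [|[|[|[|]]]] ->; nia.
  have [_ /(_ no) ->] := odd_iff _ _ _ _ E1 E2.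
  split=> [[l]|[j Dj]]; last by exists (5 * j + 4)%R; rewrite Dj; ring.
  (* Only [l = 5 a + 4] gives residue 2. *)
  have [a] := int_mod5 l; case=> [|[|[|[|]]]] ->; try nia.
  by move=> ->; exists a; ring.
- have [|b1 [b2 [-> E1 E2]]] := @c3_odd (5 * n + 3); first lia.
  have no : ~ exists l : int, (Posz (5 * n + 3) = l * (3 * l + 1))%R.
    by move=> [l]; have [a] := int_mod5 l; case=> [|[|[|[|]]]] ->; nia.
  have [/(_ no) -> _] := odd_iff _ _ _ _ E1 E2.
  rewrite triangular_pronic; split=> [[j Dj]|[j Dj]]; last by exists (5 * j + 2); lia.
  (* [j (j + 1)] is 1 modulo 5 only for [j = 5 a + 2]. *)
  exists (j %/ 5).
  have : j = 5 * (j %/ 5) + j %% 5 by lia.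
  have : j %% 5 < 5 by rewrite ltn_mod.
  move: (j %/ 5) (j %% 5) => a [|[|[|[|[|//]]]]] _ Da; subst j; nia.
- have [|b1 [b2 [-> E1 E2]]] := @c3_odd (5 * n + 4); first lia.
  have no : ~ exists l : int, (Posz (5 * n + 4) = l * (2 * l + 1))%R.
    by move=> [l]; have [a] := int_mod5 l; case=> [|[|[|[|]]]] ->; nia.
  have [_ /(_ no) ->] := odd_iff _ _ _ _ E1 E2.
  split=> [[l Dl]|[j [Dj _]]]; last by exists j.
  exists l; split=> //; move: Dl.
  by have [a] := int_mod5 l; case=> [|[|[|[|]]]] ->; nia.
Qed.
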